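(* Consider a Bayesian model $\{p(\mathbf{y}|\boldsymbol{\theta}),\pi(\boldsymbol{\theta})\}$ with the entire parameter space decomposed as $\boldsymbol{\Theta}=\Theta_1\times\cdots\times\Theta_K$ for some integer $K>1$. For each $i$ ($i=1,\dots,K$), define a functional $\mathcal{F}_i:\mathcal{Q}_{\theta_i}\to\mathbb{R}$ by $$\mathcal{F}_i\{q(\theta_i)\}:=\mathbb{E}_{q(\theta_i)}[\log\pi(\theta_{-i}|\theta_i,\mathbf{y})]-\mathrm{KL}\big(q(\theta_i)\,\|\,\pi(\theta_i|\mathbf{y})\big).$$ Then the following relations hold. (a) The functional $\mathcal{F}_i$ is concave over $\mathcal{Q}_{\theta_i}$. (b) For all densities $q(\theta_i)\in\mathcal{Q}_{\theta_i|\mathbf{y}}$, $$\mathcal{F}_i\{q(\theta_i)\}\le\log\pi(\theta_{-i}|\mathbf{y}).$$ (c) The functional $\mathcal{F}_i$ attains the value $\log\pi(\theta_{-i}|\mathbf{y})$ only at the full conditional posterior density $q(\theta_i)=\pi(\theta_i|\theta_{-i},\mathbf{y})\in\mathcal{Q}_{\theta_i|\mathbf{y}}$.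
   Context: A Bayesian model $\{p(\mathbf{y}|\boldsymbol{\theta}),\pi(\boldsymbol{\theta})\}$ consists of densities $p(\mathbf{y}|\boldsymbol{\theta})$ of the observations $\mathbf{y}$, indexed by a parameter $\boldsymbol{\theta}\in\boldsymbol{\Theta}$, and a prior density $\pi(\boldsymbol{\theta})$ supported on $\boldsymbol{\Theta}$, with finite evidence $m(\mathbf{y})=\int p(\mathbf{y}|\boldsymbol{\theta})\pi(\boldsymbol{\theta})\,d\boldsymbol{\theta}$ for all $\mathbf{y}$; the posterior density is $\pi(\boldsymbol{\theta}|\mathbf{y})=p(\mathbf{y}|\boldsymbol{\theta})\pi(\boldsymbol{\theta})/m(\mathbf{y})$. Densities are with respect to Lebesgue measure. Write $\boldsymbol{\theta}=(\theta_1,\dots,\theta_K)$ with $\theta_i\in\Theta_i$, $\Theta_{-i}=\prod_{j\ne i}\Theta_j$, and $\theta_{-i}=(\theta_1,\dots,\theta_{i-1},\theta_{i+1},\dots,\theta_K)\in\Theta_{-i}$. $\pi(\theta_i|\mathbf{y})$ and $\pi(\theta_{-i}|\mathbf{y})$ are the marginal densities of the posterior $\pi(\boldsymbol{\theta}|\mathbf{y})$, and $\pi(\theta_i|\theta_{-i},\mathbf{y})$ (the full conditional posterior density) and $\pi(\theta_{-i}|\theta_i,\mathbf{y})$ are its conditional densities, so $\pi(\boldsymbol{\theta}|\mathbf{y})=\pi(\theta_i|\theta_{-i},\mathbf{y})\,\pi(\theta_{-i}|\mathbf{y})=\pi(\theta_{-i}|\theta_i,\mathbf{y})\,\pi(\theta_i|\mathbf{y})$.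 In the definition of $\mathcal{F}_i$, $\mathbf{y}$ and $\theta_{-i}$ are held fixed and the argument is the density $q(\theta_i)$. $\mathbb{E}_{q(\theta_i)}[g(\theta_i)]=\int g(\theta_i)q(\theta_i)\,d\theta_i$, and $\mathrm{KL}(q\|p)=\int q(\theta)\log(q(\theta)/p(\theta))\,d\theta$ is the Kullback-Leibler divergence. $\mathcal{Q}_{\theta_i}$ is the collection of all densities supported on $\Theta_i$; $\mathcal{Q}_{\theta_i|\mathbf{y}}\subset\mathcal{Q}_{\theta_i}$ is the collection of only the posterior densities supported on $\Theta_i$, i.e. those conditioned on the observations $\mathbf{y}$. Typical elements of $\mathcal{Q}_{\theta_i|\mathbf{y}}$ are $\pi(\theta_i|\theta_{-i},\mathbf{y})$ and $\pi(\theta_i|\mathbf{y})$.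
   Formalization: F_i is taken with extended-real values (it need not be finite on all densities), at θ_{-i} with 0 < π(θ_{-i}|y) < ∞; in (c), attainment at the full conditional is claimed when the expectation and the KL term there are not both +∞, since otherwise F_i is undefined there. *)

(* Defs.v *)
From HB Require Import structures.
From mathcomp Require Import all_boot all_order all_algebra.
From mathcomp Require Import all_classical all_reals all_analysis.

Set Implicit Arguments.
Unset Strict Implicit.
Unset Printing Implicit Defensive.

Import Order.TTheory GRing.Theory Num.Theory numFieldNormedType.Exports.

Local Open Scope classical_set_scope.
Local Open Scope ring_scope.

(* Lebesgue measure on R^n, with R^n the type n.-tuple R: the unit mass on R^0,
   and on R^(n+1) the product of the Lebesgue measures of R and of R^n, carried
   over by (x, t) |-> x :: t. *)
Section lebesgue_cons.
Context {R : realType} (n : nat).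
Variable m : {sigma_finite_measure set (n.-tuple R) -> \bar R}.
Local Open Scope ereal_scope.

Definition tuple_cons (x : measurableTypeR R * n.-tuple R) : n.+1.-tuple R :=
  [the n.+1.-tuple R of x.1 :: x.2].

Lemma measurable_tuple_cons : measurable_fun setT tuple_cons.
Proof.
by apply: (@measurable_cons _ _ _ R fst n snd) => //; exact: measurable_fst.
Qed.

Definition lebesgue_cons : set (n.+1.-tuple R) -> \bar R :=
  pushforward (lebesgue_measure \x m) tuple_cons.

Let lebesgue_cons0 : lebesgue_cons set0 = 0.
Proof. by rewrite /lebesgue_cons /pushforward preimage_set0 measure0. Qed.

Let lebesgue_cons_ge0 A : 0 <= lebesgue_cons A.
Proof. by rewrite /lebesgue_cons /pushforward measure_ge0. Qed.

Let mpre (A : set (n.+1.-tuple R)) :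
  measurable A -> measurable (tuple_cons @^-1` A).
Proof.
by move=> mA; rewrite -[X in measurable X]setTI; exact: measurable_tuple_cons.
Qed.

Let lebesgue_cons_sigma_additive : semi_sigma_additive lebesgue_cons.
Proof.
move=> F mF tF mUF; rewrite /lebesgue_cons /pushforward preimage_bigcup.
apply: measure_semi_sigma_additive.
- by move=> k; exact: mpre.
- apply/trivIsetP => /= i j _ _ ij; rewrite -preimage_setI.
  by move/trivIsetP : tF => /(_ _ _ _ _ ij) ->//; rewrite preimage_set0.
- by rewrite -preimage_bigcup; exact: mpre.
Qed.

HB.instance Definition _ := isMeasure.Build _ _ _ lebesgue_cons
  lebesgue_cons0 lebesgue_cons_ge0 lebesgue_cons_sigma_additive.

Let lebesgue_cons_sigma_finite : sigma_finite setT lebesgue_cons.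
Proof.
have /sigma_finiteP[F [TF ndF Foo]] := sigma_finiteT (@lebesgue_measure R).
have /sigma_finiteP[G [TG ndG Goo]] := sigma_finiteT m.
pose split (t : n.+1.-tuple R) : measurableTypeR R * n.-tuple R :=
  (thead t, [tuple of behead t]).
have msplit : measurable_fun setT split.
  apply/measurable_fun_pairP; split => /=; first exact: measurable_tnth.
  exact: measurable_behead.
have splitK : split \o tuple_cons = id.
  apply/funext => -[x t]; rewrite /split /tuple_cons /=.
  by congr pair; exact/val_inj.
exists (fun k => split @^-1` (F k `*` G k)).
  rewrite -preimage_bigcup -[LHS](preimage_setT split); congr (_ @^-1` _).
  rewrite -setXTT TF TG predeqE => -[x y]; split.
    move=> [/= [k _ Fkx] [l _ Gly]]; exists (maxn k l) => //; split.
    - by move: x Fkx; exact/subsetPset/ndF/leq_maxl.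
    - by move: y Gly; exact/subsetPset/ndG/leq_maxr.
  by move=> [k _ []/= ? ?]; split; exists k.
move=> k; have [mF Fk] := Foo k; have [mG Gk] := Goo k; split.
  by rewrite -[X in measurable X]setTI; apply: msplit => //; exact: measurableX.
rewrite /lebesgue_cons /pushforward -comp_preimage splitK preimage_id.
by rewrite product_measure1E// lte_mul_pinfty// ge0_fin_numE.
Qed.

HB.instance Definition _ := Measure_isSigmaFinite.Build _ _ _ lebesgue_cons
  lebesgue_cons_sigma_finite.
End lebesgue_cons.

Fixpoint lebesgue_tuple {R : realType} n :
    {sigma_finite_measure set (n.-tuple R) -> \bar R} :=
  if n is n'.+1 then lebesgue_cons (lebesgue_tuple n')
  else \d_([tuple] : 0.-tuple R).

Section blocks.
Context {R : realType} {N : nat}.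
Implicit Types A : {set 'I_N}.

Definition subvec A (th : N.-tuple R) : #|A|.-tuple R :=
  [tuple tnth th (enum_val k) | k < #|A|].

Definition join A (u : #|A|.-tuple R) (v : #|~: A|.-tuple R) : N.-tuple R :=
  [tuple if c \in A then nth 0 u (index c (enum A))
         else nth 0 v (index c (enum (~: A))) | c < N].

Lemma join_subvec A (th : N.-tuple R) :
  join (subvec A th) (subvec (~: A) th) = th.
Proof.
apply: eq_from_tnth => c; rewrite tnth_mktuple.
have sub (B : {set 'I_N}) : c \in B ->
    nth 0 (subvec B th) (index c (enum B)) = tnth th c.
  move=> cB; have cl : (index c (enum B) < #|B|)%N.
    by rewrite cardE index_mem mem_enum.
  rewrite -[index _ _]/(nat_of_ord (Ordinal cl)) -tnth_nth tnth_mktuple.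
  by rewrite (enum_val_nth c) /= nth_index// mem_enum.
by case: ifPn => cA; rewrite sub// inE.
Qed.

Lemma subvec_join A (u : #|A|.-tuple R) (v : #|~: A|.-tuple R) :
  subvec A (join u v) = u /\ subvec (~: A) (join u v) = v.
Proof.
split; apply: eq_from_tnth => k; rewrite !tnth_mktuple.
  rewrite enum_valP (tnth_nth 0) (enum_val_nth (enum_val k)) index_uniq//.
  - by rewrite -cardE.
  - exact: enum_uniq.
have := enum_valP k; rewrite inE => /negbTE ->.
rewrite (tnth_nth 0) (enum_val_nth (enum_val k)) index_uniq//.
- by rewrite -cardE.
- exact: enum_uniq.
Qed.

(* b assigns to each of the N real coordinates of the parameter its block. *)
Definition block K (b : 'I_N -> 'I_K) (i : 'I_K) : {set 'I_N} :=
  [set c | b c == i]%SET.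

Definition product_space K (b : 'I_N -> 'I_K)
    (Theta : forall j, set (#|block b j|.-tuple R)) : set (N.-tuple R) :=
  [set th | forall j, Theta j (subvec (block b j) th)].

(* The zero vector only fills the coordinates of block i, which are not read. *)
Definition rest_space K (b : 'I_N -> 'I_K)
    (Theta : forall j, set (#|block b j|.-tuple R)) (i : 'I_K) :
    set (#|~: block b i|.-tuple R) :=
  [set t | forall j, j != i ->
     Theta j (subvec (block b j) (join (nseq_tuple #|block b i| 0) t))].

End blocks.
Arguments rest_space {R N K b} Theta i.

Section densities.
Context {R : realType} {k : nat}.
Implicit Types (D : set (k.-tuple R)) (q p : k.-tuple R -> R).
Local Open Scope ereal_scope.

Definition densities D : set (k.-tuple R -> R) :=
  [set q : k.-tuple R -> R | [/\ measurable_fun setT q, forall x, (0 <= q x)%R,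
     forall x, ~ D x -> q x = 0%R &
     \int[lebesgue_tuple k]_x (q x)%:E = 1]].

Definition expectation q (g : k.-tuple R -> \bar R) : \bar R :=
  \int[lebesgue_tuple k]_x (g x * (q x)%:E).

(* Conventions of the extended reals used here: x / 0 = +oo for x > 0,
   lne 0 = -oo, lne +oo = +oo and 0 * y = 0 for all y. *)
Definition KL q p : \bar R :=
  \int[lebesgue_tuple k]_x ((q x)%:E * lne ((q x)%:E / (p x)%:E)).

Definition concave_on (Q : set (k.-tuple R -> R))
    (F : (k.-tuple R -> R) -> \bar R) :=
  forall q1 q2 (a : R), Q q1 -> Q q2 -> (0 <= a <= 1)%R ->
    a%:E * F q1 + (1 - a)%:E * F q2 <=
    F (fun x => a * q1 x + (1 - a) * q2 x)%R.

End densities.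

Section bayes.
Context {R : realType} {N n : nat}.
Variables (p : n.-tuple R -> N.-tuple R -> R) (prior : N.-tuple R -> R).
Local Open Scope ereal_scope.

Definition evidence (y : n.-tuple R) : \bar R :=
  \int[lebesgue_tuple N]_th (p y th * prior th)%:E.

Definition posterior (y : n.-tuple R) (th : N.-tuple R) : R :=
  (p y th * prior th / fine (evidence y))%R.

Record bayes_model (Theta : set (N.-tuple R)) : Prop := BayesModel {
  likelihood_density : forall th, Theta th -> densities setT (p ^~ th) ;
  likelihood_measurable : forall y, measurable_fun Theta (p y) ;
  prior_density : densities Theta prior ;
  evidence_finite : forall y, evidence y < +oo }.

End bayes.

(* post is a density on R^N, A the set of coordinates of theta_i and ~: A that
   of theta_{-i}; u stands for theta_i and t for theta_{-i}. *)
Section functional.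
Context {R : realType} {N : nat} (A : {set 'I_N}) (post : N.-tuple R -> R).
Implicit Types (u : #|A|.-tuple R) (t : #|~: A|.-tuple R).
Local Open Scope ereal_scope.

(* fine replaces by 0 the value +oo, which the integral takes only on a
   negligible set; thus 0 < marginal_rest t says that the integral is positive
   and finite. *)
Definition marginal u : R :=
  fine (\int[lebesgue_tuple _]_t (post (join u t))%:E).

Definition marginal_rest t : R :=
  fine (\int[lebesgue_tuple _]_u (post (join u t))%:E).

Definition full_conditional t u : R :=
  (post (join u t) / marginal_rest t)%R.

Definition conditional_rest u t : \bar R :=
  (post (join u t))%:E / (marginal u)%:E.

Definition expected_log t (q : #|A|.-tuple R -> R) : \bar R :=
  expectation q (fun u => lne (conditional_rest u t)).

(* Both terms may be infinite; +oo - +oo is -oo in \bar R. *)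
Definition calF t (q : #|A|.-tuple R -> R) : \bar R :=
  expected_log t q - KL q marginal.

(* The difference above is not of the form +oo - +oo. *)
Definition calF_defined t (q : #|A|.-tuple R -> R) : bool :=
  expected_log t q +? - KL q marginal.

(* Qy is a collection of posterior densities on D: it lies between the typical
   posterior densities of theta_i and all the densities supported on D. *)
Definition posterior_collection (D : set (#|A|.-tuple R))
    (Trest : set (#|~: A|.-tuple R)) (Qy : set (#|A|.-tuple R -> R)) :=
  [/\ Qy `<=` densities D,
      densities D marginal -> Qy marginal &
      forall t, Trest t -> (0 < marginal_rest t)%R ->
        densities D (full_conditional t) -> Qy (full_conditional t)].

End functional.

(* Main.v *)
Require Import Defs.
From mathcomp Require Import all_boot all_order all_algebra.
From mathcomp Require Import all_classical all_reals all_analysis.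
From mathcomp Require Import measurable_realfun ring lra.

Set Implicit Arguments.
Unset Strict Implicit.
Unset Printing Implicit Defensive.

Import Order.TTheory GRing.Theory Num.Theory numFieldNormedType.Exports.

Local Open Scope classical_set_scope.
Local Open Scope ring_scope.

(* Fix theta_{-i} = t and write w(u) = post(u, t), M for the marginal density of
   theta_i and m for the integral of w. Wherever both integrands are finite, the
   difference between q ln(w / M) and q ln(q / M) is q ln(w / q), so that
   F q = ln m - KL(q || w / m). In order to cope with infinite integrals, this
   identity is replaced by the pointwise bound
     q ln(w / M) <= q ln(q / M) + (q ln m + w / m - q),
   an instance of ln x <= x - 1, whose bracket integrates to ln m; equality in it
   forces q = w / m. The integral of q ln(q / M) is never -oo because
   q ln(q / M) >= q - M and M is integrable. The latter is Tonelli's theorem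
   together with the fact that Lebesgue measure on R^N is the product of those of
   complementary blocks of coordinates: both agree on boxes. For the concavity,
   q ln(w / M) is affine and q ln(q / M) convex in q. *)

(** * Boxes in R^n and the uniqueness of measures determined by them *)

Section boxes.
Context {R : realType}.

Definition box n (I : 'I_n -> set R) : set (n.-tuple R) :=
  [set th | forall i, I i (tnth th i)].

Lemma measurable_box n (I : 'I_n -> set R) :
  (forall i, measurable (I i)) -> measurable (box I).
Proof.
move=> mI; rewrite (_ : box I =
    \big[setI/setT]_(i < n) (tnth (T:=R) ^~ i @^-1` I i)).
  apply: bigsetI_measurable => i _; rewrite -[X in measurable X]setTI.
  exact: measurable_tnth.
apply/seteqP; split => th /=.
  by move=> Ith; rewrite -bigcap_seq => i _; exact: Ith.
by rewrite -bigcap_seq => Ith i; apply: Ith; exact: mem_index_enum.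
Qed.

Local Open Scope ereal_scope.

(** By induction: the preimage of a box under [tuple_cons] is the product of its first side and the
    box of the others. *)
Lemma lebesgue_tuple_box n (I : 'I_n -> set R) :
  (forall i, measurable (I i)) ->
  lebesgue_tuple n (box I) = \big[mule/1]_(i < n) lebesgue_measure (I i).
Proof.
elim: n I => [|n IHn] I mI.
  rewrite big_ord0 /= diracE mem_set//= /box => i; by case: i.
rewrite big_ord_recl -IHn; last by move=> i; exact: mI.
rewrite -product_measure1E; [|exact: mI|exact: measurable_box].
congr (product_measure1 _ _ _); apply/seteqP; split => -[x th] /=.
  move=> Ith; split; first by have := Ith ord0.
  by move=> i; have := Ith (lift ord0 i); rewrite tnthS.
move=> [Ix Ith] i; have [j ->|->] := unliftP ord0 i; last exact: Ix.
rewrite tnthS; exact: Ith.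
Qed.

Lemma measurable_tuple_boxes n :
  @measurable _ (n.-tuple R) = <<s [set A | exists I : 'I_n -> set R,
     (forall i, measurable (I i)) /\ A = box I] >>.
Proof.
apply/seteqP; split.
  apply: smallest_sub; first exact: smallest_sigma_algebra.
  rewrite -bigcup_seq => A [i /= _ [B mB <-]]; apply: sub_sigma_algebra => /=.
  exists (fun j => if j == i then B else setT); split => [j|].
    by case: ifP.
  rewrite setTI; apply/seteqP; split => th /=.
    by move=> Bth j; case: eqP => // ->.
  by move/(_ i); rewrite eqxx.
apply: smallest_sub; first exact: sigma_algebra_measurable.
by move=> _ [I [mI ->]]; exact: measurable_box.
Qed.

(** Boxes form a generating class stable under intersection, and the cubes with sides [-k, k]
    exhaust the space with finite measure. *)
Lemma measure_eq_box n (m1 m2 : {measure set (n.-tuple R) -> \bar R}) :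
  (forall I : 'I_n -> set R, (forall i, measurable (I i)) ->
     m1 (box I) = m2 (box I)) ->
  (forall I : 'I_n -> set R, (forall i, measurable (I i)) ->
     (forall i, lebesgue_measure (I i) < +oo) -> m1 (box I) < +oo) ->
  forall A, measurable A -> m1 A = m2 A.
Proof.
move=> m12 m1oo.
pose g k := @box n (fun _ => [set` `[- k%:R, k%:R]%R] : set R).
apply: (measure_unique _ g (measurable_tuple_boxes n)).
- move=> _ _ [I [mI ->]] [J [mJ ->]]; exists (fun i => I i `&` J i); split.
    by move=> i; exact: measurableI.
  apply/seteqP; split => th /=; first by move=> [Ith Jth] i; split.
  by move=> IJ; split => i; have [] := IJ i.
- by move=> k; eexists; split; last reflexivity.
- apply/seteqP; split => // th _.
  (* The sum of the absolute values dominates every single coordinate. *)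
  exists (Num.truncn (\sum_(i < n) `|tnth th i|)%R).+1 => // i /=.
  rewrite in_itv/= -ler_norml; apply: ltW; apply: le_lt_trans (truncnS_gt _).
  by rewrite (bigD1 i)//= lerDl sumr_ge0.
- by move=> _ [I [mI ->]]; exact: m12.
- move=> k; apply: m1oo => // i.
  by rewrite lebesgue_measure_itv/=; case: ifP => // _; rewrite -EFinB ltry.
Qed.

End boxes.

(** * Lebesgue measure as a product over complementary blocks *)

Section join_measure.
Context {R : realType} {N : nat} (A : {set 'I_N}).

Let joinp (x : #|A|.-tuple R * #|~: A|.-tuple R) := join x.1 x.2.

Lemma measurable_join : measurable_fun setT joinp.
Proof.
apply/measurable_fun_tnthP => c.
(* Beyond the length of the tuple, [nth] is the constant 0, so the index needs no bound. *)
have mnth k d (T : measurableType d) (f : T -> k.-tuple R) j :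
    measurable_fun setT f -> measurable_fun setT (fun x => nth 0%R (f x) j).
  move=> mf; have [jk|kj] := ltnP j k.
    rewrite (_ : (fun x => _) = (fun th => tnth th (Ordinal jk)) \o f).
      by apply: measurableT_comp => //; exact: measurable_tnth.
    by apply/funext => x /=; rewrite (tnth_nth 0%R).
  rewrite (_ : (fun x => _) = cst 0%R)//; apply/funext => x.
  by rewrite nth_default// size_tuple.
rewrite (_ : _ \o _ = fun x : #|A|.-tuple R * #|~: A|.-tuple R =>
    if c \in A then nth 0%R x.1 (index c (enum A))
    else nth 0%R x.2 (index c (enum (~: A)%SET))).
  by case: (c \in A); [exact: (mnth _ _ _ fst)|exact: (mnth _ _ _ snd)].
by apply/funext => x; exact: tnth_mktuple.
Qed.

Local Open Scope ereal_scope.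

(** On a box, the preimage is a product of two boxes, and the product of the side lengths splits
    according to membership in [A]. *)
Lemma pushforward_join (B : set (N.-tuple R)) : measurable B ->
  pushforward (lebesgue_tuple #|A| \x lebesgue_tuple #|~: A|) joinp B =
  lebesgue_tuple N B.
Proof.
move=> mB; apply/esym; move: B mB; apply: measure_eq_box.
- exact: measurable_join.
- move=> mjoin I mI.
  rewrite /= lebesgue_tuple_box//= /pushforward.
  rewrite (_ : _ @^-1` _ = box (fun k : 'I_#|A| => I (enum_val k)) `*`
      box (fun k : 'I_#|~: A| => I (enum_val k))).
    rewrite product_measure1E//; [|exact: measurable_box|exact: measurable_box].
    rewrite (bigID (mem A))/= big_enum_val; congr (_ * _).
      by apply/esym; exact: lebesgue_tuple_box.
    rewrite lebesgue_tuple_box//.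
    transitivity (\big[mule/1]_(c in (~: A)%SET) lebesgue_measure (I c)).
      by apply: eq_bigl => c; rewrite inE.
    exact: big_enum_val.
  apply/seteqP; split => -[u v] /=.
    move=> Iuv; have [uE vE] := subvec_join u v.
    split => k; rewrite -?[u in tnth u _]uE -?[v in tnth v _]vE tnth_mktuple;
      exact: Iuv.
  rewrite /box /= /joinp /= => -[Iu Iv] c; have [uE vE] := subvec_join u v.
  have [cA|cA] := boolP (c \in A).
    by have := Iu (enum_rank_in cA c);
      rewrite -[u in tnth u _]uE tnth_mktuple enum_rankK_in.
  have cA' : c \in (~: A)%SET by rewrite inE.
  by have := Iv (enum_rank_in cA' c);
    rewrite -[v in tnth v _]vE tnth_mktuple enum_rankK_in.
- move=> I mI Ioo; rewrite /= lebesgue_tuple_box// -ge0_fin_numE; last first.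
    by apply: prode_ge0 => i _; exact: measure_ge0.
  by apply: prode_fin_num => i _; rewrite ge0_fin_numE.
Qed.

Lemma integral_join (f : N.-tuple R -> \bar R) :
  measurable_fun setT f -> (forall th, 0 <= f th) ->
  \int[lebesgue_tuple #|A|]_u \int[lebesgue_tuple #|~: A|]_v f (join u v) =
  \int[lebesgue_tuple N]_th f th.
Proof.
move=> mf f0.
transitivity (\int[pushforward (lebesgue_tuple #|A| \x lebesgue_tuple #|~: A|)
    joinp]_th f th).
  rewrite ge0_integral_pushforward//; last exact: measurable_join.
  rewrite preimage_setT (fubini_tonelli1 (f \o joinp))//=.
  by apply: measurableT_comp => //; exact: measurable_join.
apply: eq_measure_integral => [|? B mB _]; first exact: measurable_join.
exact: pushforward_join.
Qed.

End join_measure.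

(** * Pointwise inequalities for the two integrands *)

Section scalar.
Context {R : realType}.
Implicit Types q w M m a : R.

Lemma ln_le_subr1 x : 0 < x -> ln x <= x - 1 :> R.
Proof. by move=> x0; have := expR_ge1Dx (ln x); rewrite lnK ?posrE//; lra. Qed.

(** The bound e^z >= 1 + z is strict for z <> 0; it is applied at z = [ln x]. *)
Lemma ln_eq_subr1 x : 0 < x -> ln x = x - 1 :> R -> x = 1.
Proof.
move=> x0 lnx; have [lnx0|/expR_gt1Dx] := eqVneq (ln x) 0; first by lra.
by rewrite lnK ?posrE//; lra.
Qed.

(** This is [ln x <= x - 1] at x = w / q, multiplied by q; for q = 0 it reads 0 <= w. *)
Lemma mul_ln_sub_le q w : 0 <= q -> 0 < w -> q * (ln w - ln q) <= w - q.
Proof.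
rewrite le0r => /predU1P[->|q0] w0; first by rewrite mul0r subr0 ltW.
rewrite -ln_div ?posrE//; have := ln_le_subr1 (divr_gt0 w0 q0).
rewrite -(ler_pM2l q0) => /le_trans; apply.
by rewrite mulrBr mulr1 mulrCA divff ?gt_eqF// mulr1.
Qed.

Lemma mul_ln_sub_eq q w : 0 <= q -> 0 < w -> q * (ln w - ln q) = w - q -> q = w.
Proof.
rewrite le0r => /predU1P[->|q0] w0; first by rewrite mul0r subr0 => <-.
rewrite -ln_div ?posrE// => qw; have wq0 := divr_gt0 w0 q0.
have /(ln_eq_subr1 wq0) : ln (w / q) = w / q - 1.
  have qN0 : q != 0 by rewrite gt_eqF.
  by apply: (mulfI qN0); rewrite qw mulrBr mulr1 mulrCA divff ?gt_eqF// mulr1.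
by move/divr1_eq.
Qed.

Local Open Scope ereal_scope.

Definition ekl q M : \bar R := q%:E * lne (q%:E / M%:E).

(* With [w] the joint density at the fixed [theta_{-i}] and [M] the marginal
   density of [theta_i], the integrand of the expected log conditional. *)
Definition elog w M q : \bar R := lne (w%:E / M%:E) * q%:E.

Lemma eklE q M : (0 <= q)%R -> (0 <= M)%R -> ekl q M =
  if q == 0%R then 0 else if M == 0%R then +oo
  else (q * (ln q - ln M))%:E.
Proof.
rewrite /ekl le0r => /predU1P[->|q0]; first by rewrite eqxx mul0e.
rewrite le0r => /predU1P[->|M0]; rewrite gt_eqF//.
  by rewrite eqxx inver eqxx gt0_muley ?lte_fin//= gt0_muley.
by rewrite gt_eqF// inver gt_eqF// -EFinM lne_EFin ?divr_gt0// ln_div ?posrE.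
Qed.

Lemma ekl_posE q M : (0 <= q)%R -> (0 < M)%R ->
  ekl q M = (q * (ln q - ln M))%:E.
Proof.
move=> q0 M0; rewrite eklE// ?ltW//; case: eqP => [->|_]; first by rewrite mul0r.
by rewrite gt_eqF.
Qed.

(** The test on [w] precedes that on [M] because 0 / 0 is 0 here, with logarithm -oo. *)
Lemma elogE w M q : (0 <= w)%R -> (0 <= M)%R -> (0 <= q)%R -> elog w M q =
  if q == 0%R then 0 else if w == 0%R then -oo else if M == 0%R then +oo
  else (q * (ln w - ln M))%:E.
Proof.
rewrite /elog => w0 M0; rewrite le0r => /predU1P[->|q0].
  by rewrite eqxx mule0.
rewrite gt_eqF//; move: w0; rewrite le0r => /predU1P[->|w0].
  by rewrite eqxx mul0e /= lexx gt0_mulNye.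
rewrite gt_eqF//; move: M0; rewrite le0r => /predU1P[->|M0].
  by rewrite eqxx inver eqxx gt0_muley ?lte_fin//= gt0_mulye.
by rewrite gt_eqF// inver gt_eqF// -EFinM lne_EFin ?divr_gt0// ln_div ?posrE// muleC.
Qed.

(** Provides a minorant independent of [q]; it comes from q ln(q / M) >= q - M. *)
Lemma ekl_ge q M : (0 <= q)%R -> (0 <= M)%R -> (- M)%:E <= ekl q M.
Proof.
move=> q0 M0; rewrite eklE//; have [_|qN0] := eqVneq q 0%R.
  by rewrite lee_fin oppr_le0.
have [_|MN0] := eqVneq M 0%R; first exact: leey.
have {MN0}M0 : (0 < M)%R by rewrite lt0r MN0.
by rewrite lee_fin; have := mul_ln_sub_le q0 M0; lra.
Qed.

(** With q the mixture, add the bounds qj (ln q - ln qj) <= q - qj with weights a and 1 - a: the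
    right-hand sides cancel. If M = 0, a nonzero term of the mixture makes the right-hand side
    +oo. *)
Lemma ekl_convex q1 q2 M a : (0 <= q1)%R -> (0 <= q2)%R -> (0 <= M)%R ->
  (0 <= a <= 1)%R ->
  ekl (a * q1 + (1 - a) * q2) M <= a%:E * ekl q1 M + (1 - a)%:E * ekl q2 M.
Proof.
move=> q10 q20; rewrite le0r => /predU1P[->|M0] /andP[a0 a1].
  have ekl0 q : (0 <= q)%R -> 0 <= ekl q 0%R.
    by move=> q0; have := ekl_ge q0 (lexx 0%R); rewrite oppr0.
  have a'0 : (0 <= 1 - a)%R by lra.
  have eklM (c q : R) : (0 <= c)%R -> (0 <= q)%R -> (c * q)%R != 0%R ->
      c%:E * ekl q 0%R = +oo.
    move=> c0 q0; rewrite mulf_eq0 negb_or => /andP[cN0 qN0].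
    by rewrite eklE// eqxx (negbTE qN0) gt0_muley// lte_fin lt0r cN0.
  have [->|aq1] := eqVneq (a * q1)%R 0%R; last first.
    rewrite (eklM a)// addye ?leey// gt_eqF// (lt_le_trans ltNy0)//.
    by rewrite mule_ge0 ?ekl0.
  rewrite add0r; have [->|aq2] := eqVneq ((1 - a) * q2)%R 0%R; last first.
    rewrite (eklM (1 - a)%R)// addey ?leey// gt_eqF// (lt_le_trans ltNy0)//.
    by rewrite mule_ge0 ?ekl0.
  by rewrite eklE// eqxx adde_ge0// mule_ge0 ?ekl0.
have a'0 : (0 <= 1 - a)%R by lra.
have aq0 : (0 <= a * q1 + (1 - a) * q2)%R by rewrite addr_ge0 ?mulr_ge0.
rewrite !ekl_posE// -!EFinM -EFinD lee_fin.
set q := (a * q1 + (1 - a) * q2)%R in aq0 *.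
move: aq0; rewrite le0r => /predU1P[q_eq0|q0].
  (* A vanishing mixture of nonnegative terms has both terms zero. *)
  move/eqP: (q_eq0); rewrite paddr_eq0 ?mulr_ge0//.
  by rewrite !mulrA q_eq0 => /andP[/eqP -> /eqP ->]; rewrite !mul0r addr0.
have := ler_wpM2l a0 (mul_ln_sub_le q10 q0).
have := ler_wpM2l a'0 (mul_ln_sub_le q20 q0).
have : (q * (ln q - ln M) =
    a * q1 * (ln q - ln M) + (1 - a) * q2 * (ln q - ln M))%R.
  by rewrite -mulrDl.
have : (a * (q - q1) + (1 - a) * (q - q2) = 0)%R by rewrite /q; ring.
lra.
Qed.

Lemma elogD w M q1 q2 a : (0 <= q1)%R -> (0 <= q2)%R -> (0 <= a <= 1)%R ->
  elog w M (a * q1 + (1 - a) * q2) =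
  a%:E * elog w M q1 + (1 - a)%:E * elog w M q2.
Proof.
move=> q10 q20 /andP[a0 a1]; have a'0 : (0 <= 1 - a)%R by lra.
rewrite /elog EFinD ge0_muleDr ?lee_fin ?mulr_ge0//.
by rewrite !EFinM !(muleCA (lne _)).
Qed.

Variables (w M q m : R).
Hypotheses (w0 : (0 <= w)%R) (M0 : (0 <= M)%R).
Hypotheses (q0 : (0 <= q)%R) (m0 : (0 < m)%R).

(* The excess is [q ln m + w / m - q], so that the bound is the inequality
   [ln x <= x - 1] at [x = w / (m q)]; its integral is [ln m]. *)
Lemma elog_le : elog w M q <= ekl q M + ((ln m - 1) * q + m^-1 * w)%:E.
Proof.
rewrite elogE// eklE//; have [->|qN0] := eqVneq q 0%R.
  by rewrite mulr0 add0e add0r lee_fin mulr_ge0// invr_ge0 ltW.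
have [_|wN0] := eqVneq w 0%R; first exact: leNye.
have [_|_] := eqVneq M 0%R; first by rewrite addye// leey.
have w'0 : (0 < w)%R by rewrite lt0r wN0.
have := mul_ln_sub_le q0 (divr_gt0 w'0 m0); rewrite ln_div ?posrE//.
by rewrite -EFinD lee_fin; lra.
Qed.

(** Finiteness excludes M = 0 < q, where for w > 0 both sides are +oo and the equality does not
    determine [q]. *)
Lemma elog_eq : ekl q M \is a fin_num ->
  elog w M q = ekl q M + ((ln m - 1) * q + m^-1 * w)%:E -> q = (w / m)%R.
Proof.
rewrite elogE// eklE//; have [->|qN0] := eqVneq q 0%R.
  by rewrite mulr0 add0e add0r mulrC => _ [].
have [_|wN0] := eqVneq w 0%R; first by case: ifP.
have [//|_] := eqVneq M 0%R.
have w'0 : (0 < w)%R by rewrite lt0r wN0.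
rewrite -EFinD => _ [] e; apply: mul_ln_sub_eq => //; first exact: divr_gt0.
by rewrite ln_div ?posrE//; lra.
Qed.

Lemma elog_full :
  elog w M (w / m) = ekl (w / m) M + ((ln m - 1) * (w / m) + m^-1 * w)%:E.
Proof.
have wm0 : (0 <= w / m)%R by rewrite divr_ge0// ltW.
rewrite elogE// eklE// mulf_eq0 invr_eq0 (gt_eqF m0) orbF.
have [->|wN0] := eqVneq w 0%R; first by rewrite mul0r !mulr0 add0e addr0.
have [_|_] := eqVneq M 0%R; first by rewrite addye.
have w'0 : (0 < w)%R by rewrite lt0r wN0.
by rewrite -EFinD ln_div ?posrE//; congr EFin; lra.
Qed.

End scalar.

(** * Extended integrals without integrability assumptions *)

Section integral_facts.
Context d (T : measurableType d) {R : realType} (mu : {measure set T -> \bar R}).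
Local Open Scope ereal_scope.
Implicit Types f g : T -> \bar R.

(** Positive and negative parts are compared separately; the subtraction stays monotone at infinite
    values because +oo - +oo is -oo. *)
Lemma le_integral_measurable f g :
  measurable_fun setT f -> measurable_fun setT g -> (forall x, f x <= g x) ->
  \int[mu]_x f x <= \int[mu]_x g x.
Proof.
move=> mf mg fg; rewrite integralE [leRHS]integralE; apply: leeB.
  apply: ge0_le_integral => //; [exact: measurable_funepos|exact: measurable_funepos|].
  by move=> x _; apply: (@funepos_le _ _ setT) => //; rewrite inE.
apply: ge0_le_integral => //; [exact: measurable_funeneg|exact: measurable_funeneg|].
by move=> x _; apply: (@funeneg_le _ _ setT) => //; rewrite inE.
Qed.

(** Since +oo - +oo is -oo, a finite difference forces both parts to have finite integrals. *)
Lemma fin_num_integrable f : measurable_fun setT f ->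
  \int[mu]_x f x \is a fin_num -> mu.-integrable setT f.
Proof.
move=> mf; rewrite integralE fin_numB => /andP[fp fn].
apply/integrableP; split => //.
rewrite (_ : (fun x => _) = abse \o f)// fune_abse.
rewrite ge0_integralD//; [|exact: measurable_funepos|exact: measurable_funeneg].
rewrite lte_add_pinfty// -ge0_fin_numE//; exact: integral_ge0.
Qed.

Lemma ge0_integrable (f : T -> R) : measurable_fun setT f ->
  (forall x, 0 <= f x)%R -> \int[mu]_x (f x)%:E < +oo ->
  mu.-integrable setT (EFin \o f).
Proof.
move=> mf f0 foo; apply/integrableP; split; first exact/measurable_EFinP.
by under eq_integral do rewrite /= ger0_norm//.
Qed.

End integral_facts.

(** * The variational principle on an abstract measure space *)

Section gibbs_variational.
Context d (T : measurableType d) {R : realType} (mu : {measure set T -> \bar R}).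
Variables (w M : T -> R) (m : R).
Hypotheses (mw : measurable_fun setT w) (w0 : forall x, 0 <= w x).
Hypotheses (mM : measurable_fun setT M) (M0 : forall x, 0 <= M x).
Hypotheses (Moo : (\int[mu]_x (M x)%:E < +oo)%E).
Hypotheses (m0 : 0 < m) (intw : (\int[mu]_x (w x)%:E = m%:E)%E).
Local Open Scope ereal_scope.

Definition prob_density (q : T -> R) := [/\ measurable_fun setT q,
  (forall x, 0 <= q x)%R & \int[mu]_x (q x)%:E = 1].

Definition Eelog q := \int[mu]_x elog (w x) (M x) (q x).
Definition Iekl q := \int[mu]_x ekl (q x) (M x).
(** Convertible with [calF] once [w] is the slice of the posterior at [t] and [M] its marginal. *)
Definition variational q := Eelog q - Iekl q.
Local Notation F := variational.
Definition excess (q : T -> R) x := ((ln m - 1) * q x + m^-1 * w x)%R.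
Local Notation h := excess.

Lemma measurable_ekl q : prob_density q ->
  measurable_fun setT (fun x => ekl (q x) (M x)).
Proof.
move=> [mq q0 _]; under eq_fun do rewrite eklE//.
apply: measurable_fun_ifT => //; first exact: measurable_fun_eqr.
apply: measurable_fun_ifT => //; first exact: measurable_fun_eqr.
apply/measurable_EFinP; apply: measurable_funM => //.
by apply: measurable_funB; exact: measurableT_comp.
Qed.

Lemma measurable_elog q : prob_density q ->
  measurable_fun setT (fun x => elog (w x) (M x) (q x)).
Proof.
move=> [mq q0 _]; under eq_fun do rewrite elogE//.
apply: measurable_fun_ifT => //; first exact: measurable_fun_eqr.
apply: measurable_fun_ifT => //; first exact: measurable_fun_eqr.
apply: measurable_fun_ifT => //; first exact: measurable_fun_eqr.
apply/measurable_EFinP; apply: measurable_funM => //.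
by apply: measurable_funB; exact: measurableT_comp.
Qed.

Let integrable_density q : prob_density q -> mu.-integrable setT (EFin \o q).
Proof. by move=> [mq q0 q1]; apply: ge0_integrable => //; rewrite q1 ltry. Qed.

Let integrable_w : mu.-integrable setT (EFin \o w).
Proof. by apply: ge0_integrable => //; rewrite intw ltry. Qed.

Let excessE q x :
  (h q x)%:E = (ln m - 1)%:E * (EFin \o q) x + m^-1%:E * (EFin \o w) x.
Proof. by []. Qed.

Lemma integrable_excess q : prob_density q -> mu.-integrable setT (EFin \o h q).
Proof.
move=> dq; apply: (@integrableD _ _ _ mu setT measurableT
  (fun x => (ln m - 1)%:E * (EFin \o q) x) (fun x => m^-1%:E * (EFin \o w) x)).
- by apply: integrableZl => //; exact: integrable_density.
- exact: integrableZl.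
Qed.

(** The masses 1 of [q] and m of [w] contribute [ln m - 1] and 1. *)
Lemma integral_excess q : prob_density q -> \int[mu]_x (h q x)%:E = (ln m)%:E.
Proof.
move=> dq; have [mq q0 q1] := dq; under eq_integral do rewrite excessE.
rewrite integralD//; last 2 first.
- by apply: integrableZl => //; exact: integrable_density.
- exact: integrableZl.
rewrite !integralZl//; last exact: integrable_density.
by rewrite q1 intw mule1 -EFinM mulVf ?gt_eqF// -EFinD subrK.
Qed.

Lemma Iekl_gtNy q : prob_density q -> -oo < Iekl q.
Proof.
move=> dq; have [mq q0 _] := dq.
have iM : mu.-integrable setT (EFin \o M) by exact: ge0_integrable.
apply: (@lt_le_trans _ _ (\int[mu]_x - (EFin \o M) x)).
  rewrite integralN; last by rewrite fin_num_adde_defl// fin_numN integrable_neg_fin_num.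
  by rewrite ltNye_eq fin_numN integrable_fin_num.
apply: le_integral_measurable; last by move=> x; exact: ekl_ge.
  by apply: measurableT_comp => //; exact/measurable_EFinP.
exact: measurable_ekl.
Qed.

Lemma integrable_ekl q : prob_density q -> Iekl q < +oo ->
  mu.-integrable setT (fun x => ekl (q x) (M x)).
Proof.
move=> dq Ioo; apply: fin_num_integrable; first exact: measurable_ekl.
by rewrite fin_real// Iekl_gtNy.
Qed.

Let F_fin_num q : prob_density q -> F q \is a fin_num ->
  mu.-integrable setT (fun x => elog (w x) (M x) (q x)) /\
  mu.-integrable setT (fun x => ekl (q x) (M x)).
Proof.
move=> dq; rewrite /variational fin_numB => /andP[Efin Ifin]; split.
  by apply: fin_num_integrable => //; exact: measurable_elog.
by apply: fin_num_integrable => //; exact: measurable_ekl.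
Qed.

Lemma gibbs_le q : prob_density q -> F q <= (ln m)%:E.
Proof.
move=> dq; have [mq q0 _] := dq; rewrite /variational.
(* An infinite divergence gives the value -oo, even if the expected logarithm is +oo. *)
have [Ioo|] := ltP (Iekl q) +oo; last first.
  by rewrite leye_eq => /eqP ->; rewrite addeNy leNye.
have iI := integrable_ekl dq Ioo.
have Ifin : Iekl q \is a fin_num by exact: integrable_fin_num.
rewrite leeBlDr// addeC -(integral_excess dq) -integralD//; last exact: integrable_excess.
apply: le_integral_measurable; first exact: measurable_elog.
  exact: (measurable_int mu (integrableD measurableT iI (integrable_excess dq))).
by move=> x; exact: elog_le.
Qed.

(** The gap in [elog_le] has integral 0 and is nonnegative almost everywhere, hence vanishes almost
    everywhere; [elog_eq] then applies pointwise. *)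
Lemma gibbs_eq q : prob_density q -> F q = (ln m)%:E ->
  {ae mu, forall x, q x = (w x / m)%R}.
Proof.
move=> dq Fq; have [mq q0 _] := dq.
have [iE iI] : mu.-integrable setT (fun x => elog (w x) (M x) (q x)) /\
    mu.-integrable setT (fun x => ekl (q x) (M x)).
  by apply: F_fin_num; rewrite // Fq.
have ih := integrable_excess dq.
pose g x := ekl (q x) (M x) + (h q x)%:E.
have ig : mu.-integrable setT g by exact: integrableD.
have iD : mu.-integrable setT (g \- (fun x => elog (w x) (M x) (q x))).
  exact: integrableB.
have Ifin : Iekl q \is a fin_num by exact: integrable_fin_num.
have Efin : Eelog q \is a fin_num by exact: integrable_fin_num.
have D0 : \int[mu]_x (g \- (fun x => elog (w x) (M x) (q x))) x = 0.
  rewrite integralB// integralD// integral_excess// -Fq /variational.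
  rewrite -/(Iekl q) -/(Eelog q).
  move: Ifin Efin; case: (Iekl q) => // k _; case: (Eelog q) => // e _.
  by apply: (congr1 EFin (_ : k + (e - k) - e = 0)%R); ring.
(* Where both terms are +oo their difference is -oo, so the sign is only available where they are
   finite, that is, almost everywhere. *)
have ae_ge0 : ae_eq mu setT (abse \o (g \- (fun x => elog (w x) (M x) (q x))))
    (g \- (fun x => elog (w x) (M x) (q x))).
  apply: filterS2 (integrable_ae measurableT ig) (integrable_ae measurableT iE).
  move=> x /(_ Logic.I) gfin /(_ Logic.I) efin _ /=.
  by rewrite gee0_abs// subre_ge0//; exact: elog_le.
have : \int[mu]_x `|(g \- (fun x => elog (w x) (M x) (q x))) x| = 0.
  rewrite -[RHS]D0; apply: ae_eq_integral => //.
    by apply: measurableT_comp => //; exact: (measurable_int mu iD).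
  exact: (measurable_int mu iD).
move/(ae_eq_integral_abs mu measurableT (measurable_int mu iD)).
have := integrable_ae measurableT iI; have := integrable_ae measurableT iE.
apply: filterS3 => x /(_ Logic.I) efin /(_ Logic.I) kfin /(_ Logic.I) /= gx.
apply: (elog_eq (w0 x) (M0 x) (q0 x) m0 kfin).
move: gx kfin efin; rewrite /g /excess; case: (ekl _ _) => // k + _.
by case: (elog _ _ _) => // e + _; move=> /(congr1 fine) /= ?; congr EFin; lra.
Qed.

(** If the divergence is finite, integrate [elog_full]. If it is +oo, definedness keeps the expected
    logarithm below +oo and the minorant -M + [excess] keeps it above -oo; being finite, it would
    make the divergence finite too. *)
Lemma gibbs_full : prob_density (fun x => (w x / m)%R) ->
  (Eelog (fun x => (w x / m)%R) +? - Iekl (fun x => (w x / m)%R)) ->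
  F (fun x => (w x / m)%R) = (ln m)%:E.
Proof.
set q := fun x => (w x / m)%R => dq def.
have ih := integrable_excess dq.
have eE x : elog (w x) (M x) (q x) = ekl (q x) (M x) + (h q x)%:E.
  exact: elog_full.
have [Ioo|] := ltP (Iekl q) +oo.
  have iI := integrable_ekl dq Ioo.
  rewrite /variational /Eelog (eq_integral _ _ (fun x _ => eE x)).
  rewrite integralD// integral_excess// -/(Iekl q) addeAC subee ?add0e//.
  exact: integrable_fin_num.
rewrite leye_eq => /eqP Iy; exfalso; move: def; rewrite Iy /=.
have [Eoo|] := ltP (Eelog q) +oo; last by rewrite leye_eq => /eqP ->.
have eE' : (fun x => ekl (q x) (M x)) =
    (fun x => elog (w x) (M x) (q x)) \- (EFin \o h q).
  by apply/funext => x /=; rewrite eE addeK.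
have /negP : ~~ (-oo < Eelog q).
  apply/negP => ENy; have : mu.-integrable setT (fun x => elog (w x) (M x) (q x)).
    by apply: fin_num_integrable; [exact: measurable_elog|rewrite fin_real// ENy].
  move=> /integrableB => /(_ measurableT _ ih); rewrite -eE' => /integrable_fin_num.
  by rewrite -/(Iekl q) Iy => /(_ measurableT).
move=> + _; apply.
have iM : mu.-integrable setT (fun x => - (EFin \o M) x + (h q x)%:E).
  apply: integrableD => //; apply: integrableN => //; exact: ge0_integrable.
apply: (@lt_le_trans _ _ (\int[mu]_x (- (EFin \o M) x + (h q x)%:E))).
  by rewrite ltNye_eq integrable_fin_num.
apply: le_integral_measurable.
- exact: (measurable_int mu iM).
- exact: measurable_elog.
- move=> x; rewrite eE.
  by apply: leeD2r; apply: ekl_ge => //; have [_ ->] := dq.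
Qed.

Lemma gibbs_concave q1 q2 (a : R) : prob_density q1 -> prob_density q2 ->
  (0 <= a <= 1)%R ->
  a%:E * F q1 + (1 - a)%:E * F q2 <= F (fun x => a * q1 x + (1 - a) * q2 x)%R.
Proof.
move=> d1 d2 a01; have /andP[a0 a1] := a01.
have a'0 : (0 <= 1 - a)%R by rewrite subr_ge0.
(* The endpoints are treated apart: 0 * -oo is 0, whereas a positive weight preserves -oo. *)
have [aE|aN0] := eqVneq a 0%R.
  rewrite aE mul0e add0e subr0 mul1e.
  by under eq_fun do rewrite mul0r add0r mul1r.
have [aE|aN1] := eqVneq a 1%R.
  rewrite aE subrr mul0e adde0 mul1e.
  by under eq_fun do rewrite mul0r addr0 mul1r.
have a_gt0 : (0 < a)%R by rewrite lt0r aN0.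
have a'_gt0 : (0 < 1 - a)%R by rewrite subr_gt0 lt_def eq_sym aN1.
(* The value +oo is excluded by [gibbs_le]. A value -oo makes the left-hand side -oo; otherwise all
   four integrals are finite. *)
have F_fin q : prob_density q -> F q != -oo -> F q \is a fin_num.
  by move=> dq FN; rewrite fin_real// ltNye FN (le_lt_trans (gibbs_le dq))// ltry.
have [F1|/(F_fin _ d1) F1] := eqVneq (F q1) -oo.
  by rewrite F1 gt0_muleNy// addNye leNye.
have [F2|/(F_fin _ d2) F2] := eqVneq (F q2) -oo.
  by rewrite F2 gt0_muleNy// addeNy leNye.
have [iE1 iI1] := F_fin_num d1 F1; have [iE2 iI2] := F_fin_num d2 F2.
have [mq1 q10 _] := d1; have [mq2 q20 _] := d2.
set q := fun x => (a * q1 x + (1 - a) * q2 x)%R.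
have EE : Eelog q = a%:E * Eelog q1 + (1 - a)%:E * Eelog q2.
  rewrite /Eelog; under eq_integral do rewrite elogD//.
  rewrite integralD//; [|exact: integrableZl|exact: integrableZl].
  by rewrite !integralZl.
have dq : prob_density q.
  split=> [|x|].
  - by apply: measurable_funD; exact: measurable_funM.
  - by rewrite addr_ge0// mulr_ge0.
  - under eq_integral do rewrite EFinD 2!EFinM.
    have i1 := integrable_density d1; have i2 := integrable_density d2.
    rewrite (@integralD _ _ _ mu setT measurableT (fun x => a%:E * (EFin \o q1) x)
      (fun x => (1 - a)%:E * (EFin \o q2) x));
      [|exact: integrableZl|exact: integrableZl].
    rewrite !integralZl//; have [_ _ ->] := d1; have [_ _ ->] := d2.
    by rewrite !mule1 -EFinD addrC subrK.
have II : Iekl q <= a%:E * Iekl q1 + (1 - a)%:E * Iekl q2.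
  have i1 := integrableZl measurableT a iI1.
  have i2 := integrableZl measurableT (1 - a)%R iI2.
  rewrite -[a%:E * _]integralZl// -[(1 - a)%:E * _]integralZl// -integralD//.
  apply: le_integral_measurable; first exact: measurable_ekl.
    exact: (measurable_int mu (integrableD measurableT i1 i2)).
  by move=> x; exact: ekl_convex.
rewrite /variational EE; apply: le_trans (leeB (lexx _) II).
have := integrable_fin_num measurableT iE1; rewrite -/(Eelog q1).
have := integrable_fin_num measurableT iE2; rewrite -/(Eelog q2).
have := integrable_fin_num measurableT iI1; rewrite -/(Iekl q1).
have := integrable_fin_num measurableT iI2; rewrite -/(Iekl q2).
case: (Eelog q1) => // e1; case: (Eelog q2) => // e2.
case: (Iekl q1) => // k1; case: (Iekl q2) => // k2 _ _ _ _.
rewrite -[leLHS]/(a * (e1 - k1) + (1 - a) * (e2 - k2))%:E.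
rewrite -[leRHS]/(a * e1 + (1 - a) * e2 - (a * k1 + (1 - a) * k2))%:E lee_fin.
lra.
Qed.

End gibbs_variational.

(** * Sign, measurability and finite mass of the posterior *)

Section posterior_facts.
Context {R : realType} {K N n : nat} (b : 'I_N -> 'I_K).
Variable Theta : forall j : 'I_K, set (#|block b j|.-tuple R).
Hypothesis mTheta : forall j, measurable (@Theta j).
Variables (p : n.-tuple R -> N.-tuple R -> R) (prior : N.-tuple R -> R).
Hypothesis model : bayes_model p prior (product_space (@Theta)).
Variable y : n.-tuple R.

Lemma measurable_subvec (A : {set 'I_N}) :
  measurable_fun setT (@subvec R N A).
Proof.
apply/measurable_fun_tnthP => k.
rewrite (_ : _ \o _ = fun th : N.-tuple R => tnth th (enum_val k)).
  exact: measurable_tnth.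
by apply/funext => th; exact: tnth_mktuple.
Qed.

Lemma measurable_product_space : measurable (product_space (@Theta)).
Proof.
rewrite (_ : product_space (@Theta) =
    \big[setI/setT]_(j < K) (@subvec R N (block b j) @^-1` @Theta j)).
  apply: bigsetI_measurable => j _; rewrite -[X in measurable X]setTI.
  exact: (measurable_subvec measurableT (@mTheta j)).
apply/seteqP; split => th /=.
  by move=> Tth; rewrite -bigcap_seq => j _; exact: Tth.
by rewrite -bigcap_seq => Tth j; apply: Tth; exact: mem_index_enum.
Qed.

Lemma prior_out th : ~ product_space (@Theta) th -> prior th = 0.
Proof. by case: (prior_density model) => _ _ + _; apply. Qed.

Lemma joint_ge0 th : 0 <= p y th * prior th.
Proof.
have [_ prior0 _ _] := prior_density model.
have [Tth|/prior_out ->] := pselect (product_space (@Theta) th); last by rewrite mulr0.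
by have [_ p0 _ _] := likelihood_density model Tth; rewrite mulr_ge0.
Qed.

(** The likelihood is measurable only on the parameter space; extending it by 0 leaves the product
    unchanged because the prior vanishes outside. *)
Lemma measurable_joint : measurable_fun setT (fun th => p y th * prior th).
Proof.
have [mprior _ _ _] := prior_density model.
rewrite (_ : (fun th => _) = (p y \_ (product_space (@Theta))) \* prior).
  apply: measurable_funM => //.
  apply/(measurable_restrictT _ measurable_product_space).
  exact: (likelihood_measurable model).
apply/funext => th /=; rewrite patchE; case: ifPn => //.
by rewrite notin_setE => /prior_out ->; rewrite !mulr0.
Qed.

Lemma posterior_ge0 th : 0 <= posterior p prior y th.
Proof.
apply: divr_ge0; first exact: joint_ge0.
by apply: fine_ge0; apply: integral_ge0 => x _; rewrite lee_fin joint_ge0.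
Qed.

Lemma measurable_posterior : measurable_fun setT (posterior p prior y).
Proof. by apply: measurable_funM => //; exact: measurable_joint. Qed.

Lemma posterior_out th : ~ product_space (@Theta) th -> posterior p prior y th = 0.
Proof. by move=> /prior_out th0; rewrite /posterior th0 mulr0 mul0r. Qed.

(** Finiteness covers the case of zero evidence, where division by 0 makes the posterior identically
    0. *)
Lemma integral_posterior_lty :
  (\int[lebesgue_tuple N]_th (posterior p prior y th)%:E < +oo)%E.
Proof.
under eq_integral do rewrite /posterior mulrC EFinM.
have ev0 : (0 <= evidence p prior y)%E.
  by apply: integral_ge0 => th _; rewrite lee_fin joint_ge0.
rewrite ge0_integralZl//.
- apply: lte_mul_pinfty => //; last exact: (evidence_finite model).
  by rewrite lee_fin invr_ge0 fine_ge0.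
- by apply/measurable_EFinP; exact: measurable_joint.
- by move=> th _; rewrite lee_fin joint_ge0.
- by rewrite lee_fin invr_ge0 fine_ge0.
Qed.

End posterior_facts.

(** * Marginals and slices of a nonnegative function *)

Section marginals.
Context {R : realType} {N : nat} (A : {set 'I_N}) (post : N.-tuple R -> R).
Hypotheses (mpost : measurable_fun setT post) (post0 : forall th, 0 <= post th).
Local Open Scope ereal_scope.

Let mpost2 : measurable_fun setT
  (fun x : #|A|.-tuple R * #|~: A|.-tuple R => (post (join x.1 x.2))%:E).
Proof.
by apply/measurable_EFinP; apply: measurableT_comp => //; exact: measurable_join.
Qed.

Lemma measurable_marginal : measurable_fun setT (@marginal R N A post).
Proof.
apply: (@measurableT_comp _ _ _ _ _ _ fine); first exact: fine_measurable.
apply: (measurable_fun_fubini_tonelli_F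
  (fun x : #|A|.-tuple R * #|~: A|.-tuple R => (post (join x.1 x.2))%:E)) => //.
by move=> x; rewrite lee_fin.
Qed.

Lemma marginal_ge0 u : (0 <= @marginal R N A post u)%R.
Proof. by apply: fine_ge0; apply: integral_ge0 => t _; rewrite lee_fin. Qed.

(** By Tonelli, with an inequality because [fine] replaces infinite inner integrals by 0. *)
Lemma integral_marginal_le :
  \int[lebesgue_tuple #|A|]_u (@marginal R N A post u)%:E <=
  \int[lebesgue_tuple N]_th (post th)%:E.
Proof.
rewrite -(@integral_join R N A (EFin \o post)); last 2 first.
- exact/measurable_EFinP.
- by move=> th; rewrite lee_fin.
have int0 (u : #|A|.-tuple R) :
    0 <= \int[lebesgue_tuple #|~: A|]_t (post (join u t))%:E.
  by apply: integral_ge0 => t _; rewrite lee_fin.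
apply: ge0_le_integral => //.
- by move=> u _; rewrite lee_fin marginal_ge0.
- by apply/measurable_EFinP; exact: measurable_marginal.
- apply: (measurable_fun_fubini_tonelli_F
    (fun x : #|A|.-tuple R * #|~: A|.-tuple R => (post (join x.1 x.2))%:E)) => //.
  by move=> x; rewrite lee_fin.
- move=> u _; rewrite /marginal /=.
  by case: (\int[_]_(_ in _) _) (int0 u) => [r||]//= _; rewrite leey.
Qed.

Lemma measurable_slice t :
  measurable_fun setT (fun u : #|A|.-tuple R => post (join u t)).
Proof.
apply: measurableT_comp => //.
apply: (@measurableT_comp _ _ _ _ _ _
  (fun x : #|A|.-tuple R * #|~: A|.-tuple R => join x.1 x.2)
  _ (fun u : #|A|.-tuple R => (u, t))); first exact: measurable_join.
exact: measurable_fun_pair.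
Qed.

(** Positivity rules out an infinite integral, which [fine] would send to 0. *)
Lemma integral_slice t : (0 < @marginal_rest R N A post t)%R ->
  \int[lebesgue_tuple #|A|]_u (post (join u t))%:E = (marginal_rest post t)%:E.
Proof.
rewrite /marginal_rest; case: (\int[_]_(_ in _) _) => //=; by rewrite ltxx.
Qed.

End marginals.

Theorem corollary5p1 (R : realType) (K N n : nat) (K_gt1 : (1 < K)%N)
    (b : 'I_N -> 'I_K)
    (Theta : forall j : 'I_K, set (#|block b j|.-tuple R))
    (mTheta : forall j, measurable (Theta j))
    (p : n.-tuple R -> N.-tuple R -> R) (prior : N.-tuple R -> R)
    (model : bayes_model p prior (product_space Theta))
    (y : n.-tuple R) (i : 'I_K)
    (Qy : set (#|block b i|.-tuple R -> R))
    (Qy_posterior : posterior_collection (posterior p prior y)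
       (Theta i) (rest_space Theta i) Qy)
    (t : #|~: block b i|.-tuple R)
    (t_rest : rest_space Theta i t)
    (t_gt0 : 0 < marginal_rest (posterior p prior y) t) :
  let F := calF (posterior p prior y) t in
  let m := marginal_rest (posterior p prior y) t in
  let full := full_conditional (posterior p prior y) t in
  [/\ concave_on (densities (Theta i)) F,
      forall q, Qy q -> (F q <= (ln m)%:E)%E &
      [/\ forall q, densities (Theta i) q -> F q = (ln m)%:E ->
            {ae lebesgue_tuple #|block b i|, forall u, q u = full u},
          Qy full &
          calF_defined (posterior p prior y) t full -> F full = (ln m)%:E]].
Proof.
move=> F m full.
set post := posterior p prior y in F m full t_gt0 Qy_posterior *.
have mpost : measurable_fun setT post := measurable_posterior mTheta model y.
have post0 th : 0 <= post th := posterior_ge0 model y th.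
set w := fun u : #|block b i|.-tuple R => post (join u t).
set M := @marginal R N (block b i) post.
have mw : measurable_fun setT w by exact: measurable_slice.
have w0 u : 0 <= w u by exact: post0.
have mM : measurable_fun setT M by exact: measurable_marginal.
have M0 u : 0 <= M u by exact: marginal_ge0.
have Moo : (\int[lebesgue_tuple #|block b i|]_u (M u)%:E < +oo)%E.
  apply: le_lt_trans (integral_marginal_le _ mpost post0) _.
  exact: integral_posterior_lty.
have intw : (\int[lebesgue_tuple #|block b i|]_u (w u)%:E = m%:E)%E.
  exact: integral_slice.
have dens q : densities (Theta i) q -> prob_density (lebesgue_tuple #|block b i|) q.
  by case.
have dfull : densities (Theta i) full.
  split=> [|u|u Tu|].
  - exact: measurable_funM.
  - by apply: divr_ge0 => //; exact: ltW.
  (* Block [i] of [join u t] is [u], so for [u] outside [Theta i] the joined vector lies outside the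
     product space. *)
  - rewrite /full /full_conditional [post _](posterior_out model) ?mul0r// => Tjoin.
    by apply: Tu; have := Tjoin i; have [-> _] := subvec_join u t.
  - under eq_integral do rewrite /full /full_conditional mulrC EFinM.
    rewrite ge0_integralZl//.
    + by rewrite [X in (_ * X)%E]intw -EFinM mulVf// gt_eqF.
    + exact/measurable_EFinP.
    + by move=> u _; rewrite lee_fin.
    + by rewrite lee_fin invr_ge0 ltW.
have [Qsub _ Qfull] := Qy_posterior.
(* Each analytic claim is now the abstract principle for [w], [M] and [m], up to unfolding
   [calF]. *)
split=> [q1 q2 a /dens d1 /dens d2|q /Qsub/dens|].
- exact: (gibbs_concave mw w0 mM M0 Moo t_gt0 intw d1 d2).
- exact: (gibbs_le mw w0 mM M0 Moo t_gt0 intw).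
split=> [q /dens||].
- exact: (gibbs_eq mw w0 mM M0 t_gt0 intw).
- exact: Qfull.
- exact: (gibbs_full mw w0 mM M0 Moo t_gt0 intw (dens _ dfull)).
Qed.
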